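(* Let $\mathbf{s}_i$, $i=0,\ldots,4$, be the spherical control points of the hodograph of an RRMF5-I curve. Then $$\mathbf s_1\in \mathcal C(\mathbf s_0,\mathbf s_2), \qquad \mathbf s_2\in \mathcal C(\mathbf s_0,\mathbf s_4),\qquad \mathbf s_3\in \mathcal C(\mathbf s_4,\mathbf s_2).$$
   Context: Let $\mathbb H$ be the quaternions, with pure vector quaternions identified with $\mathbb R^3$; $\mathcal A^*$ denotes conjugation and $\mathrm{vect}(\mathcal A)$ the vector part. Fix a unit pure vector $\mathbf i$. Let $B_i^n(t)=\binom ni t^i(1-t)^{n-i}$. An RRMF5-I curve (quintic curve of class I with rational rotation-minimizing frame) is a polynomial curve $\mathbf r:[0,1]\to\mathbb R^3$ whose hodograph is $\mathbf h(t)=\mathbf r'(t)=\mathcal A(t)\,\mathbf i\,\mathcal A^*(t)$, where $\mathcal A(t)=\mathcal A_0B_0^2(t)+\mathcal A_1B_1^2(t)+\mathcal A_2B_2^2(t)$ is a quaternion polynomial (the pre-image) with $\mathcal A_0,\mathcal A_1,\mathcal A_2\in\mathbb H$ satisfying $$\mathcal A_1\,\mathbf i\,\mathcal A_1^*=\mathrm{vect}(\mathcal A_2\,\mathbf i\,\mathcal A_0^* ).$$ The hodograph control points $\mathbf h_0,\ldots,\mathbf h_4\in\mathbb R^3$ are the Bernstein coefficients in $\mathbf h(t)=\sum_{i=0}^4\mathbf h_iB_i^4(t)$. When $\mathbf h_i\neq\mathbf 0$ for all $i=0,\ldots,4$, the spherical control points are $\mathbf s_i=\mathbf h_i/|\mathbf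 h_i|\in\mathbb S^2$; speaking of spherical control points presupposes that all $\mathbf h_i$ are nonzero. For $\mathbf v,\mathbf w\in\mathbb S^2$, $\mathcal C(\mathbf v,\mathbf w)$ denotes the set of points of $\mathbb S^2$ having the same angular distance from $\mathbf v$ and $\mathbf w$, i.e. $\{\mathbf x\in\mathbb S^2:\mathbf x\cdot\mathbf v=\mathbf x\cdot\mathbf w\}$ (a great circle if $\mathbf v\neq\mathbf w$). *)

(* Defs.v *)
From HB Require Import structures.
From mathcomp Require Import all_boot all_order all_algebra.
From mathcomp Require Import ring.
From mathcomp Require Import boolp classical_sets reals.

Set Implicit Arguments.
Unset Strict Implicit.
Unset Printing Implicit Defensive.

Import Order.TTheory GRing.Theory Num.Theory.

Local Open Scope ring_scope.

Section VectorProducts.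
Variable R : comNzRingType.
Implicit Types u v w : 'rV[R]_3.

Definition dotv u v : R := (u *m v^T) 0 0.

Definition crossv u v : 'rV[R]_3 :=
  \row_j (u 0 (j + 1) * v 0 (j + 2) - u 0 (j + 2) * v 0 (j + 1)).

Lemma dotvE u v : dotv u v = u 0 0 * v 0 0 + u 0 1 * v 0 1 + u 0 2 * v 0 2.
Proof.
rewrite /dotv mxE !big_ord_recl big_ord0 addr0 !mxE addrA.
by congr (_ * _ + _ * _ + _ * _); congr (_ 0 _); apply: val_inj.
Qed.

Lemma crossvE u v :
  [/\ crossv u v 0 0 = u 0 1 * v 0 2 - u 0 2 * v 0 1,
      crossv u v 0 1 = u 0 2 * v 0 0 - u 0 0 * v 0 2
    & crossv u v 0 2 = u 0 0 * v 0 1 - u 0 1 * v 0 0].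
Proof.
split; rewrite mxE; congr (_ * _ - _ * _); congr (_ 0 _); exact: val_inj.
Qed.

Lemma rV3_eq u v : u 0 0 = v 0 0 -> u 0 1 = v 0 1 -> u 0 2 = v 0 2 -> u = v.
Proof.
move=> e0 e1 e2; apply/rowP => -[[|[|[|//]]] lt_j3].
- by rewrite (_ : Ordinal lt_j3 = 0) //; apply: val_inj.
- by rewrite (_ : Ordinal lt_j3 = 1) //; apply: val_inj.
- by rewrite (_ : Ordinal lt_j3 = 2) //; apply: val_inj.
Qed.

End VectorProducts.

(* A quaternion is the pair of its scalar part and its vector part. *)
Definition quat (R : comNzRingType) := (R^o * 'rV[R]_3)%type.

Section Quaternions.
Variable R : comNzRingType.
Implicit Types a b c : quat R.

HB.instance Definition _ := GRing.Lmodule.copy (quat R) (R^o * 'rV[R]_3)%type.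

Definition scal a : R := a.1.
Definition vect a : 'rV[R]_3 := a.2.
Definition pure (v : 'rV[R]_3) : quat R := (0, v).
Definition qconj a : quat R := (scal a, - vect a).

Definition qone : quat R := (1, 0).
Definition qmul a b : quat R :=
  (scal a * scal b - dotv (vect a) (vect b),
   scal a *: vect b + scal b *: vect a + crossv (vect a) (vect b)).

Lemma quat_eq a b : scal a = scal b -> vect a 0 0 = vect b 0 0 ->
  vect a 0 1 = vect b 0 1 -> vect a 0 2 = vect b 0 2 -> a = b.
Proof.
case: a b => [a u] [b v] /= eq_ab e0 e1 e2.
by congr pair => //; apply: rV3_eq.
Qed.

Let crossv0 u v := let: And3 e _ _ := @crossvE R u v in e.
Let crossv1 u v := let: And3 _ e _ := @crossvE R u v in e.
Let crossv2 u v := let: And3 _ _ e := @crossvE R u v in e.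

Lemma scal_qmul a b : scal (qmul a b) =
  scal a * scal b - (vect a 0 0 * vect b 0 0 + vect a 0 1 * vect b 0 1
                     + vect a 0 2 * vect b 0 2).
Proof. by rewrite -dotvE. Qed.

Lemma vect_qmul0 a b : vect (qmul a b) 0 0 =
  scal a * vect b 0 0 + scal b * vect a 0 0
  + (vect a 0 1 * vect b 0 2 - vect a 0 2 * vect b 0 1).
Proof. by rewrite -crossv0 /vect /= !mxE. Qed.

Lemma vect_qmul1 a b : vect (qmul a b) 0 1 =
  scal a * vect b 0 1 + scal b * vect a 0 1
  + (vect a 0 2 * vect b 0 0 - vect a 0 0 * vect b 0 2).
Proof. by rewrite -crossv1 /vect /= !mxE. Qed.

Lemma vect_qmul2 a b : vect (qmul a b) 0 2 =
  scal a * vect b 0 2 + scal b * vect a 0 2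
  + (vect a 0 0 * vect b 0 1 - vect a 0 1 * vect b 0 0).
Proof. by rewrite -crossv2 /vect /= !mxE. Qed.

Let qmulE := (scal_qmul, vect_qmul0, vect_qmul1, vect_qmul2).

Lemma scalD a b : scal (a + b) = scal a + scal b. Proof. by []. Qed.
Lemma vectD a b : vect (a + b) = vect a + vect b. Proof. by []. Qed.

Let vectDE a b j : vect (a + b) 0 j = vect a 0 j + vect b 0 j.
Proof. by rewrite vectD mxE. Qed.
Let vect1E j : vect qone 0 j = 0. Proof. by rewrite mxE. Qed.
Let scal1E : scal qone = 1. Proof. by []. Qed.
Let quatE := (qmulE, scalD, vectDE, vect1E, scal1E).

Lemma qmulA : associative qmul.
Proof. by move=> a b c; apply: quat_eq; rewrite !quatE; ring. Qed.

Lemma qmul1q : left_id qone qmul.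
Proof. by move=> a; apply: quat_eq; rewrite !quatE; ring. Qed.

Lemma qmulq1 : right_id qone qmul.
Proof. by move=> a; apply: quat_eq; rewrite !quatE; ring. Qed.

Lemma qmulDl : left_distributive qmul +%R.
Proof. by move=> a b c; apply: quat_eq; rewrite !quatE; ring. Qed.

Lemma qmulDr : right_distributive qmul +%R.
Proof. by move=> a b c; apply: quat_eq; rewrite !quatE; ring. Qed.

Lemma qone_neq0 : qone != 0.
Proof. by apply/eqP => -[/eqP]; rewrite oner_eq0. Qed.

HB.instance Definition _ := GRing.Zmodule_isNzRing.Build (quat R)
  qmulA qmul1q qmulq1 qmulDl qmulDr qone_neq0.

Lemma qmulrE a b : a * b = qmul a b. Proof. by []. Qed.

End Quaternions.

Section Curves.
Variable R : realType.
Implicit Types (i v w x : 'rV[R]_3) (t : R).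

Definition bernstein (n k : nat) t : R :=
  'C(n, k)%:R * t ^+ k * (1 - t) ^+ (n - k).

Definition bezier (V : lmodType R) (n : nat) (c : 'I_n.+1 -> V) t : V :=
  \sum_(k < n.+1) bernstein n k t *: c k.

(* The library norm of a row vector is the maximum norm. *)
Definition enorm v : R := Num.sqrt (dotv v v).

Definition S2 : set 'rV[R]_3 := [set x | enorm x = 1].

Definition equidistant v w : set 'rV[R]_3 :=
  [set x | S2 x /\ dotv x v = dotv x w].

(* A polynomial curve in R^3 is given by its three coordinate polynomials. *)
Definition hodograph (r : 'rV[{poly R}]_3) t : 'rV[R]_3 :=
  \row_j (r 0 j)^`().[t].

Definition RRMF5_I i (r : 'rV[{poly R}]_3) : Prop :=
  exists A : 'I_3 -> quat R,
    A 1 * pure i * qconj (A 1) = pure (vect (A 2 * pure i * qconj (A 0))) /\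
    forall t, 0 <= t <= 1 ->
      pure (hodograph r t) = bezier A t * pure i * qconj (bezier A t).

Definition hodograph_control_points (r : 'rV[{poly R}]_3)
    (h : 'I_5 -> 'rV[R]_3) : Prop :=
  forall t, 0 <= t <= 1 -> hodograph r t = bezier h t.

Definition spherical_control_points (r : 'rV[{poly R}]_3)
    (s : 'I_5 -> 'rV[R]_3) : Prop :=
  exists h : 'I_5 -> 'rV[R]_3,
    [/\ hodograph_control_points r h,
        forall k, h k != 0
      & forall k, s k = (enorm (h k))^-1 *: h k].

End Curves.

Arguments S2 {R}.

(* Main.v *)
Require Import Defs.
From mathcomp Require Import all_boot all_order all_algebra.
From mathcomp Require Import ring.
From mathcomp Require Import boolp classical_sets reals.

(** Write [polar i a b] for the vector part of [a i b^*], a symmetric bilinear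
    map of the quaternions [a] and [b] that polarizes [a |-> a i a^*].
    Expanding the hodograph bilinearly, its control points are
    - [h_0 = polar A_0 A_0], [h_1 = polar A_0 A_1], [h_3 = polar A_1 A_2],
      [h_4 = polar A_2 A_2],
    - [h_2 = (polar A_0 A_2 + 2 polar A_1 A_1) / 3], which the RRMF5-I
      condition [polar A_1 A_1 = polar A_2 A_0] turns into both
      [polar A_1 A_1] and [polar A_0 A_2].

    All three claims are now one fact about two quaternions [a] and [b]
    ([normalized_polar_equidistant]): the direction of [polar a b] is
    equidistant from those of [polar a a] and [polar b b].  Indeed, for a unit
    vector [i], the vector [polar a a] has length [|a|^2], and
    [polar a b . polar a a = |a|^2 <a, b>] ([dot_polar]), so the cosine of the
    angle between [polar a b] and [polar a a] is [<a, b> / |polar a b|], which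
    is symmetric in [a] and [b].  The pairs to consider are [(A_0, A_1)],
    [(A_0, A_2)] and [(A_2, A_1)].

    Reading off the control points from the values of the curve on [[0, 1]]
    uses the uniqueness of Bernstein coefficients ([bezier_inj]). *)

Set Implicit Arguments.
Unset Strict Implicit.
Unset Printing Implicit Defensive.

Import Order.TTheory GRing.Theory Num.Theory.

Local Open Scope ring_scope.

(** * Uniqueness of Bernstein coefficients *)

Lemma natr_roots_eq0 (R : numDomainType) (p : {poly R}) :
  (forall n : nat, p.[n%:R] = 0) -> p = 0.
Proof.
move=> p0; apply/eqP/negPn/negP => p_neq0.
pose rs : seq R := [seq n%:R | n <- iota 0 (size p)].
have : (size rs < size p)%N.
  apply: max_poly_roots => //.
    by apply/allP => _ /mapP[n _ ->]; rewrite /root p0.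
  rewrite map_inj_uniq ?iota_uniq //.
  by move=> m n /eqP; rewrite eqr_nat => /eqP.
by rewrite size_map size_iota ltnn.
Qed.

(** The substitution [t = u / (1 + u)] maps [u >= 0] into [[0, 1]] and turns
    the Bernstein polynomials, up to a common factor, into multiples of the
    monomials. *)
Lemma bernstein_subst (R : realType) (n k : nat) (u : R) :
  (k <= n)%N -> 0 <= u ->
  bernstein n k (u / (1 + u)) = 'C(n, k)%:R * u ^+ k / (1 + u) ^+ n.
Proof.
move=> le_kn u_ge0; have u1_neq0 : 1 + u != 0 by rewrite gt_eqF // ltr_pwDl.
have -> : bernstein n k (u / (1 + u))
    = 'C(n, k)%:R * (u / (1 + u)) ^+ k * (1 + u)^-1 ^+ (n - k).
  by rewrite /bernstein; congr (_ * _ ^+ _); field.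
by rewrite expr_div_n -!mulrA -exprVn -exprD subnKC // exprVn.
Qed.

Lemma bezier_row (R : realType) (m n : nat) (c : 'I_n.+1 -> 'rV[R]_m) t j :
  bezier c t 0 j = \sum_(k < n.+1) bernstein n k t * c k 0 j.
Proof. by rewrite summxE; apply: eq_bigr => k _; rewrite mxE. Qed.

Lemma bezier_inj (R : realType) (m n : nat) (c d : 'I_n.+1 -> 'rV[R]_m) :
  (forall t, 0 <= t <= 1 -> bezier c t = bezier d t) -> c =1 d.
Proof.
move=> eq_cd k; apply/rowP => j; apply/eqP; rewrite -subr_eq0.
pose e l := c l 0 j - d l 0 j.
(* Up to a power of [1 + u], the value of [p] at [u] is the [j]-th coordinate
   of [bezier c t - bezier d t] at [t = u / (1 + u)]. *)
pose p := \poly_(l < n.+1) ('C(n, l)%:R * e (inord l)).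
have p0 : p = 0.
  apply: natr_roots_eq0 => N; set u : R := N%:R.
  have u_ge0 : 0 <= u by rewrite ler0n.
  have u1_gt0 : 0 < 1 + u by rewrite ltr_pwDl.
  have /eq_cd/rowP/(_ j)/eqP : 0 <= u / (1 + u) <= 1.
    by rewrite divr_ge0 ?(ltW u1_gt0) //= ler_pdivrMr // mul1r lerDr.
  rewrite !bezier_row -subr_eq0 -sumrB.
  rewrite (eq_bigr (fun l : 'I_n.+1 =>
             'C(n, l)%:R * e (inord l) * u ^+ l * (1 + u) ^- n)); last first.
    move=> l _; rewrite -mulrBr bernstein_subst ?leq_ord // inord_val /e.
    by ring.
  rewrite -mulr_suml mulf_eq0 invr_eq0 expf_eq0 (gt_eqF u1_gt0) andbF orbF.
  by rewrite horner_poly => /eqP.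
have /eqP := congr1 (fun q : {poly R} => q`_k) p0.
rewrite coef_poly ltn_ord coef0 inord_val mulf_eq0 pnatr_eq0.
by rewrite -leqn0 leqNgt bin_gt0 leq_ord.
Qed.

(** * The polarized rotation map *)

Section Polar.
Variables (R : comNzRingType) (i : 'rV[R]_3).
Implicit Types a b c : quat R.

Definition polar a b : 'rV[R]_3 := vect (a * pure i * qconj b).

(** The inner product of [R^4]; [qdot a a] is the squared quaternion norm. *)
Definition qdot a b : R := scal a * scal b + dotv (vect a) (vect b).

Lemma scal_scale (k : R) a : scal (k *: a) = k * scal a. Proof. by []. Qed.
Lemma vect_scale (k : R) a j : vect (k *: a) 0 j = k * vect a 0 j.
Proof. by rewrite /vect mxE. Qed.
Lemma vect_add a b j : vect (a + b) 0 j = vect a 0 j + vect b 0 j.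
Proof. by rewrite /vect mxE. Qed.
Lemma vect_conj a j : vect (qconj a) 0 j = - vect a 0 j.
Proof. by rewrite /vect mxE. Qed.
Lemma scal_conj a : scal (qconj a) = scal a. Proof. by []. Qed.
Lemma scal_pure (v : 'rV[R]_3) : scal (pure v) = 0. Proof. by []. Qed.
Lemma vect_pure (v : 'rV[R]_3) : vect (pure v) = v. Proof. by []. Qed.

Let quatE := (qmulrE, scal_qmul, vect_qmul0, vect_qmul1, vect_qmul2,
  scal_scale, vect_scale, scalD, vect_add, vect_conj, scal_conj,
  scal_pure, vect_pure).

(** Since [i] is pure, the conjugate of [a i b^*] is [- b i a^*], and
    conjugation changes the sign of the vector part. *)
Lemma polarC a b : polar a b = polar b a.
Proof. by apply: rV3_eq; rewrite /polar !quatE; ring. Qed.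

Lemma polarDl a b c : polar (a + b) c = polar a c + polar b c.
Proof. by apply: rV3_eq; rewrite [RHS]mxE /polar !quatE; ring. Qed.

Lemma polarZl (k : R) a b : polar (k *: a) b = k *: polar a b.
Proof. by apply: rV3_eq; rewrite [RHS]mxE /polar !quatE; ring. Qed.

Lemma polarDr a b c : polar a (b + c) = polar a b + polar a c.
Proof. by rewrite polarC polarDl !(polarC _ a). Qed.

Lemma polarZr (k : R) a b : polar a (k *: b) = k *: polar a b.
Proof. by rewrite polarC polarZl polarC. Qed.

Lemma qdotC a b : qdot a b = qdot b a.
Proof. by rewrite /qdot !dotvE; ring. Qed.

(** As [u . v] is the scalar part of [u v^*] for pure [u] and [v], the left
    side is the scalar part of [- a i b^* a i a^*]: the outer factors [a] and
    [a^*] contribute [|a|^2], then the two factors [i] contribute [|i|^2],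
    which leaves the scalar part [<a, b>] of [b^* a]. *)
Lemma dot_polar a b :
  dotv (polar a b) (polar a a) = dotv i i * qdot a a * qdot a b.
Proof. by rewrite /qdot !dotvE /polar !quatE; ring. Qed.

End Polar.

(** * Directions of polarized vectors *)

Section Directions.
Variable R : realType.
Implicit Types (i u v : 'rV[R]_3) (a b : quat R).

Definition normalize v := (enorm v)^-1 *: v.

Lemma dotvZ (k l : R) u v : dotv (k *: u) (l *: v) = k * l * dotv u v.
Proof. by rewrite !dotvE !mxE; ring. Qed.

Lemma dotv_ge0 v : 0 <= dotv v v.
Proof. by rewrite dotvE -!expr2 !addr_ge0 ?sqr_ge0. Qed.

Lemma dotv_eq0 v : (dotv v v == 0) = (v == 0).
Proof.
apply/eqP/eqP => [|->]; last by rewrite dotvE !mxE !mulr0 !addr0.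
rewrite dotvE -!expr2 => /eqP.
rewrite !paddr_eq0 ?addr_ge0 ?sqr_ge0 // !sqrf_eq0 -andbA.
by move=> /and3P[/eqP e0 /eqP e1 /eqP e2]; apply: rV3_eq; rewrite mxE.
Qed.

Lemma normalize_S2 v : v != 0 -> S2 (normalize v).
Proof.
move=> v_neq0; rewrite /S2 /= {1}/enorm /normalize dotvZ.
have dv : dotv v v = enorm v ^+ 2 by rewrite /enorm sqr_sqrtr ?dotv_ge0.
have : enorm v != 0 by rewrite -sqrf_eq0 -dv dotv_eq0.
by rewrite dv => nv; rewrite -expr2 -exprMn mulVf // expr1n sqrtr1.
Qed.

Lemma S2_dotv i : S2 i -> dotv i i = 1.
Proof. by move=> i1; rewrite -[LHS]sqr_sqrtr ?dotv_ge0 // [Num.sqrt _]i1 expr1n. Qed.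

Lemma enorm_polar i a : S2 i -> enorm (polar i a a) = qdot a a.
Proof.
move=> /S2_dotv i1; rewrite /enorm dot_polar i1 mul1r -expr2.
by rewrite sqrtr_sqr ger0_norm // /qdot -expr2 addr_ge0 ?sqr_ge0 ?dotv_ge0.
Qed.

Lemma dot_normalize_polar i a b : S2 i -> polar i a a != 0 ->
  dotv (normalize (polar i a b)) (normalize (polar i a a))
    = (enorm (polar i a b))^-1 * qdot a b.
Proof.
move=> i1 a_neq0; rewrite /normalize dotvZ dot_polar enorm_polar // S2_dotv //.
have a0 : qdot a a != 0.
  by move: a_neq0; rewrite -dotv_eq0 dot_polar S2_dotv // mul1r mulf_eq0 orbb.
by rewrite mul1r mulrA -(mulrA (_^-1)) mulVf // mulr1.
Qed.

(** The cosine computed in [dot_normalize_polar] is symmetric in [a] and [b],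
    and so is [polar]. *)
Lemma normalized_polar_equidistant i a b : S2 i ->
  polar i a a != 0 -> polar i b b != 0 -> polar i a b != 0 ->
  normalize (polar i a b)
    \in equidistant (normalize (polar i a a)) (normalize (polar i b b)).
Proof.
move=> i1 a0 b0 ab0; rewrite inE; split; first exact: normalize_S2.
by rewrite dot_normalize_polar // polarC dot_normalize_polar // qdotC.
Qed.

End Directions.

(** * Control points of the hodograph *)

Section ControlPoints.
Variables (R : realType) (i : 'rV[R]_3) (A : 'I_3 -> quat R).

(** Multiplying out two quadratic Bernstein forms, [polar (A k) (A l)]
    contributes to the control point of index [k + l] with weight
    ['C(2, k) * 'C(2, l) / 'C(4, k + l)]; by symmetry of [polar], the middle
    weights are [1/6 + 1/6] for the pair [{0, 2}] and [4/6] for [{1, 1}]. *)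
Definition polar_control_points (k : 'I_5) : 'rV[R]_3 :=
  nth 0 [:: polar i (A 0) (A 0); polar i (A 0) (A 1);
            3^-1 *: (polar i (A 0) (A 2) + 2 *: polar i (A 1) (A 1));
            polar i (A 1) (A 2); polar i (A 2) (A 2)] k.

Lemma polar_bezier t :
  polar i (bezier A t) (bezier A t) = bezier polar_control_points t.
Proof.
have bezA : bezier A t = (1 - t) ^+ 2 *: A 0
    + ((2 * t * (1 - t)) *: A 1 + t ^+ 2 *: A 2).
  rewrite /bezier !big_ord_recl big_ord0 addr0 /bernstein /=.
  have -> : lift ord0 (ord0 : 'I_2) = 1 by apply: val_inj.
  have -> : lift ord0 (lift ord0 (ord0 : 'I_1)) = 2 by apply: val_inj.
  by congr (_ *: _ + (_ *: _ + _ *: _)); rewrite /bump /= /binomial /=; ring.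
apply/rowP => j; rewrite bezA bezier_row !big_ord_recl big_ord0 addr0.
rewrite /polar_control_points /bernstein /bump /=.
rewrite !(polarDl, polarDr, polarZl, polarZr).
rewrite (polarC _ (A 1) (A 0)) (polarC _ (A 2) (A 0)) (polarC _ (A 2) (A 1)).
have three_neq0 : 3 != 0 :> R by rewrite pnatr_eq0.
(* Abstracting the vectors keeps [mxE] from unfolding the products inside. *)
do 6 move: (polar _ _ _) => ?.
by rewrite !mxE /binomial /=; field.
Qed.

End ControlPoints.

Theorem proposition3p1 (R : realType) (i : 'rV[R]_3) (hi : i \in S2)
    (r : 'rV[{poly R}]_3) (hr : RRMF5_I i r)
    (s : 'I_5 -> 'rV[R]_3) (hs : spherical_control_points r s) :
  [/\ s 1 \in equidistant (s 0) (s 2),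
      s 2 \in equidistant (s 0) (s 4)
    & s 3 \in equidistant (s 4) (s 2)].
Proof.
have i1 : S2 i by move: hi; rewrite inE.
have [A [rrmf hodA]] := hr; have [h [hodh h_neq0 sE]] := hs.
have polar11 : polar i (A 1) (A 1) = polar i (A 0) (A 2).
  by rewrite (polarC _ (A 0)) /polar rrmf.
have hE : h =1 polar_control_points i A.
  apply: bezier_inj => t t01.
  by rewrite -polar_bezier -hodh // /polar -hodA.
have h0 : h 0 = polar i (A 0) (A 0) by rewrite hE.
have h1 : h 1 = polar i (A 0) (A 1) by rewrite hE.
have h2 : h 2 = polar i (A 1) (A 1).
  rewrite hE /polar_control_points /= -polar11.
  by rewrite -[X in X + _]scale1r -scalerDl scalerA mulVf ?scale1r // pnatr_eq0.
have h3 : h 3 = polar i (A 2) (A 1) by rewrite hE polarC.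
have h4 : h 4 = polar i (A 2) (A 2) by rewrite hE.
have := (h_neq0 0, h_neq0 1, h_neq0 2, h_neq0 3, h_neq0 4).
rewrite !sE h0 h1 h2 h3 h4 => -[[[[n0 n1] n2] n3] n4].
split; [| rewrite polar11 |]; apply: normalized_polar_equidistant => //.
by rewrite -polar11.
Qed.
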